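(* Let $\hat A=A+v_1c^\top\phi(A)$ and $\hat B=(I+v_1c^\top A^{r-1})B$. Consider the linear matrix inequalities in the unknowns $Q\in\mathbb{R}^{n\times n}$ symmetric positive definite and $Y\in\mathbb{R}^{m\times n}$: $$AQ+QA^\top+BY+Y^\top B^\top\prec 0,\qquad \hat AQ+Q\hat A^\top+\hat BY+Y^\top\hat B^\top\prec 0.$$ These are feasible if and only if there exists a gain $K\in\mathbb{R}^{m\times n}$ such that the corresponding matrices $A_0=A-BK$ and $\tilde A$ admit a common quadratic Lyapunov function. In this case, for $Q,Y$ satisfying the inequalities, $P=Q^{-1}$ and $K=-YQ^{-1}$ are such that $x^\top Px$ is a common quadratic Lyapunov function for $A_0$ and $\tilde A$, and the origin is globally exponentially stable for the closed-loop system $\dot x=F(x)$ corresponding to this $K$.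
   Context: Data: $A\in\mathbb{R}^{n\times n}$, $B\in\mathbb{R}^{n\times m}$ with $(A,B)$ stabilizable; $c\in\mathbb{R}^n$, $d\in\mathbb{R}$ with $d>0$; $h(x)=c^\top x+d$. The integer $r\ge 1$ is the relative degree of $h$ for $\dot x=Ax+Bu$: $c^\top A^iB=0$ for $0\le i\le r-2$ and $c^\top A^{r-1}B\neq 0$. $\alpha_1,\dots,\alpha_r>0$ are constants and $\alpha=\prod_{i=1}^r\alpha_i$. $G\in\mathbb{R}^{m\times m}$ is symmetric positive definite. Notation: $\phi(s)=\prod_{j=1}^{r}(s+\alpha_j)$; $\theta=c^\top A^{r-1}B\,G^{-1}B^\top(A^\top)^{r-1}c>0$; $v_1=-\frac{1}{\theta}B\,G^{-1}B^\top(A^\top)^{r-1}c$ (independent of $K$). For a gain $K\in\mathbb{R}^{m\times n}$ define $A_0=A-BK$, $v_2^\top=c^\top(\phi(A)-A^{r-1}BK)$, $\tilde A=A_0+v_1v_2^\top$, $\tilde b=\alpha d\,v_1$, $\eta(x)=v_2^\top x+\alpha d$. Closed-loop system corresponding to $K$: $\dot x=F(x)$ with $F(x)=A_0x$ if $\eta(x)\ge 0$ and $F(x)=\tilde A x+\tilde b$ if $\eta(x)<0$. It arises from $\dot x=Ax+Bu^*(x)$, where $u^*(x)$ is the safety filter, i.e. the minimizer of $\frac12 (u+Kx)^\top G(u+Kx)$ over $u\in\mathbb{R}^m$ subject to $c^\top\phi(A)x+c^\top A^{r-1}Bu+\alpha d\ge 0$. $M\prec0$ means $M$ is symmetric negative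 definite. Matrices $A_1,A_2$ admit a common quadratic Lyapunov function $x^\top Px$ if $P$ is symmetric positive definite with $PA_i+A_i^\top P\prec0$ for $i=1,2$. Globally exponentially stable: there exist $M,\mu>0$ such that every solution satisfies $\|x(t)\|\le Me^{-\mu t}\|x(0)\|$ for all $t\ge0$. *)

(* Defs.v *)
From mathcomp Require Import all_boot all_order all_algebra.
From mathcomp Require Import all_classical all_reals all_analysis.
From mathcomp Require Import complex.

Set Implicit Arguments.
Unset Strict Implicit.
Unset Printing Implicit Defensive.

Import Order.TTheory GRing.Theory Num.Theory.
Import numFieldNormedType.Exports.

Local Open Scope classical_set_scope.
Local Open Scope ring_scope.

Definition posdefmx (R : realType) (n : nat) (M : 'M[R]_n) : Prop :=
  M^T = M /\ forall x : 'cV[R]_n, x != 0 -> 0 < (x^T *m M *m x) 0 0.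

Definition negdefmx (R : realType) (n : nat) (M : 'M[R]_n) : Prop :=
  M^T = M /\ forall x : 'cV[R]_n, x != 0 -> (x^T *m M *m x) 0 0 < 0.

Definition common_lyapunov (R : realType) (n : nat) (A1 A2 P : 'M[R]_n) :
    Prop :=
  [/\ posdefmx P,
      negdefmx (P *m A1 + A1^T *m P) &
      negdefmx (P *m A2 + A2^T *m P)].

Definition hurwitz (R : realType) (n : nat) (M : 'M[R]_n) : Prop :=
  forall z : R[i],
    eigenvalue (map_mx (real_complex R) M) z -> complex.Re z < 0.

Definition stabilizable (R : realType) (n m : nat)
    (A : 'M[R]_n) (B : 'M[R]_(n, m)) : Prop :=
  exists K : 'M[R]_(m, n), hurwitz (A - B *m K).

Definition relative_degree (R : realType) (n m : nat)
    (A : 'M[R]_n.+1) (B : 'M[R]_(n.+1, m)) (c : 'cV[R]_n.+1) (r : nat) :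
    Prop :=
  [/\ (1 <= r)%N,
      forall i : nat, (i + 2 <= r)%N -> c^T *m A ^+ i *m B = 0 &
      c^T *m A ^+ r.-1 *m B != 0].

Definition phi (R : realType) (r : nat) (alpha : 'I_r -> R) : {poly R} :=
  \prod_(j < r) ('X + (alpha j)%:P).

Definition theta (R : realType) (n m : nat) (A : 'M[R]_n.+1)
    (B : 'M[R]_(n.+1, m)) (c : 'cV[R]_n.+1) (G : 'M[R]_m) (r : nat) : R :=
  (c^T *m A ^+ r.-1 *m B *m invmx G *m B^T *m A^T ^+ r.-1 *m c) 0 0.

Definition v1 (R : realType) (n m : nat) (A : 'M[R]_n.+1)
    (B : 'M[R]_(n.+1, m)) (c : 'cV[R]_n.+1) (G : 'M[R]_m) (r : nat) :
    'cV[R]_n.+1 :=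
  - (theta A B c G r)^-1 *: (B *m invmx G *m B^T *m A^T ^+ r.-1 *m c).

Definition v2T (R : realType) (n m : nat) (A : 'M[R]_n.+1)
    (B : 'M[R]_(n.+1, m)) (c : 'cV[R]_n.+1) (r : nat) (alpha : 'I_r -> R)
    (K : 'M[R]_(m, n.+1)) : 'rV[R]_n.+1 :=
  c^T *m (horner_mx A (phi alpha) - A ^+ r.-1 *m B *m K).

Definition A0 (R : realType) (n m : nat) (A : 'M[R]_n.+1)
    (B : 'M[R]_(n.+1, m)) (K : 'M[R]_(m, n.+1)) : 'M[R]_n.+1 :=
  A - B *m K.

Definition Atilde (R : realType) (n m : nat) (A : 'M[R]_n.+1)
    (B : 'M[R]_(n.+1, m)) (c : 'cV[R]_n.+1) (G : 'M[R]_m) (r : nat)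
    (alpha : 'I_r -> R) (K : 'M[R]_(m, n.+1)) : 'M[R]_n.+1 :=
  A0 A B K + v1 A B c G r *m v2T A B c alpha K.

Definition btilde (R : realType) (n m : nat) (A : 'M[R]_n.+1)
    (B : 'M[R]_(n.+1, m)) (c : 'cV[R]_n.+1) (d : R) (G : 'M[R]_m) (r : nat)
    (alpha : 'I_r -> R) : 'cV[R]_n.+1 :=
  ((\prod_(j < r) alpha j) * d) *: v1 A B c G r.

Definition eta (R : realType) (n m : nat) (A : 'M[R]_n.+1)
    (B : 'M[R]_(n.+1, m)) (c : 'cV[R]_n.+1) (d : R) (r : nat)
    (alpha : 'I_r -> R) (K : 'M[R]_(m, n.+1)) (x : 'cV[R]_n.+1) : R :=
  (v2T A B c alpha K *m x) 0 0 + (\prod_(j < r) alpha j) * d.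

(* The vector field A x + B u*(x), where u*(x) minimizes
   (u + K x)^T G (u + K x) / 2 over the inputs u such that
   c^T phi(A) x + c^T A^(r-1) B u + alpha d >= 0 (safety filter), written out
   according to whether u = - K x satisfies that constraint. *)
Definition closed_loop (R : realType) (n m : nat) (A : 'M[R]_n.+1)
    (B : 'M[R]_(n.+1, m)) (c : 'cV[R]_n.+1) (d : R) (G : 'M[R]_m) (r : nat)
    (alpha : 'I_r -> R) (K : 'M[R]_(m, n.+1)) (x : 'cV[R]_n.+1) :
    'cV[R]_n.+1 :=
  if 0 <= eta A B c d alpha K x then A0 A B K *m x
  else Atilde A B c G alpha K *m x + btilde A B c d G alpha.

(* The norm [`|x|] that the library puts on matrices is the maximum norm. *)
Definition euclidean_norm (R : realType) (n : nat) (x : 'cV[R]_n) : R :=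
  Num.sqrt (\sum_(i < n) x i 0 ^+ 2).

(* Solutions on [0, +oo[: the values of [x] at negative times are irrelevant,
   so only continuity from the right is required at time 0. *)
Definition is_solution (R : realType) (n : nat) (F : 'cV[R]_n -> 'cV[R]_n)
    (x : R -> 'cV[R]_n) : Prop :=
  {within [set t : R | 0 <= t], continuous x} /\
  forall t : R, 0 < t -> is_derive t 1 x (F (x t)).

Definition globally_exponentially_stable (R : realType) (n : nat)
    (F : 'cV[R]_n -> 'cV[R]_n) : Prop :=
  exists M mu : R, [/\ 0 < M, 0 < mu &
    forall x : R -> 'cV[R]_n, is_solution F x ->
    forall t : R, 0 <= t ->
      euclidean_norm (x t) <= M * expR (- mu * t) * euclidean_norm (x 0)].

(* Main.v *)
Require Import Defs.
From mathcomp Require Import all_boot all_order all_algebra.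
From mathcomp Require Import all_classical all_reals all_analysis.
From mathcomp Require Import ring lra.

Import Order.TTheory GRing.Theory Num.Theory.
Import numFieldNormedType.Exports.

Local Open Scope classical_set_scope.
Local Open Scope ring_scope.

Set Implicit Arguments.
Unset Strict Implicit.
Unset Printing Implicit Defensive.

(** With [K = - Y Q^-1], that is [Y = - K Q], the left-hand sides of the two
    matrix inequalities are [A0 Q + Q A0^T] and [Atilde Q + Q Atilde^T]
    ([A0_lmi], [Atilde_lmi], [lmi_lhs]), and the congruence by [Q^-1] turns them
    into the Lyapunov inequalities for [P = Q^-1] ([negdefmx_lyapunov_inv]).
    Inversion being an involution on positive definite matrices, the same
    congruence leads back from [P] to [Q]; this is the equivalence.

    For the stability, write [w = alpha d > 0]. Where [eta x < 0] the closed
    loop is [A0 x + eta(x) v1], while [Atilde x = A0 x + (eta(x) - w) v1].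
    Since [eta(x) / (eta(x) - w)] lies between 0 and 1, the vector field is at
    every point a convex combination of [A0 x] and [Atilde x]
    ([closed_loop_convex]): the affine term only pulls the field towards
    [A0 x]. The derivative of [x^T P x] along a solution is linear in the field,
    so it is bounded by the worse of the two quadratic decay rates, and the
    usual comparison argument gives exponential decay
    ([lyapunov_exponential_stability]).

    The quantitative input is that a positive definite form dominates a multiple
    of the squared Euclidean norm ([posdefmx_coercive]). It comes with an
    explicit constant from the Cauchy-Schwarz inequality, without any
    compactness argument. *)

(** * Definite quadratic forms *)

Section Forms.
Variables (R : realType) (n : nat).
Implicit Types (M A P Q : 'M[R]_n) (x y z : 'cV[R]_n).

Definition bform M x y : R := (x^T *m M *m y) 0 0.

Lemma bformE M x y :
  bform M x y = \sum_i \sum_j M i j * (x i 0 * y j 0).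
Proof.
rewrite /bform -mulmxA mxE; apply: eq_bigr => i _.
rewrite mxE mxE mulr_sumr; apply: eq_bigr => j _; ring.
Qed.

Lemma bformDl M x y z : bform M (x + y) z = bform M x z + bform M y z.
Proof. by rewrite /bform linearD /= !mulmxDl mxE. Qed.

Lemma bformDr M x y z : bform M z (x + y) = bform M z x + bform M z y.
Proof. by rewrite /bform mulmxDr mxE. Qed.

Lemma bformZl M a x y : bform M (a *: x) y = a * bform M x y.
Proof. by rewrite /bform linearZ /= -!scalemxAl mxE. Qed.

Lemma bformZr M a x y : bform M x (a *: y) = a * bform M x y.
Proof. by rewrite /bform -!scalemxAr mxE. Qed.

Lemma bformC M x y : M^T = M -> bform M x y = bform M y x.
Proof.
move=> sM; rewrite /bform -[in LHS]sM.
have -> : x^T *m M^T *m y = (y^T *m M *m x)^T.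
  by rewrite !trmx_mul trmxK mulmxA.
by rewrite mxE.
Qed.

Lemma bform_lyapunov P A x :
  bform (P *m A + A^T *m P) x x = bform P x (A *m x) + bform P (A *m x) x.
Proof. by rewrite /bform mulmxDr mulmxDl mxE !mulmxA trmx_mul. Qed.

Definition sqnorm x : R := \sum_i x i 0 ^+ 2.

Lemma sqnorm_ge0 x : 0 <= sqnorm x.
Proof. by apply: sumr_ge0 => i _; exact: sqr_ge0. Qed.

Lemma bform_ge0 M x : posdefmx M -> 0 <= bform M x x.
Proof.
move=> [_ pM]; have [->|/pM/ltW//] := eqVneq x 0.
by rewrite /bform mulmx0 mxE.
Qed.

Lemma Cauchy_Schwarz_bform M x y : posdefmx M ->
  bform M y x ^+ 2 <= bform M y y * bform M x x.
Proof.
move=> pM; have [->|y0] := eqVneq y 0.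
  by rewrite /bform trmx0 !mul0mx mxE expr0n mul0r.
have qy : 0 < bform M y y by apply: pM.2.
(* This vector is [bform M y y] times the component of [x] orthogonal to [y]. *)
have := bform_ge0 (bform M y y *: x + (- bform M y x) *: y) pM.
rewrite !(bformDl, bformDr, bformZl, bformZr) (bformC x y pM.1).
move=> h; rewrite -subr_ge0 -(pmulr_rge0 _ qy).
by apply: le_trans h _; rewrite le_eqVlt; apply/orP; left; apply/eqP; ring.
Qed.

Lemma posdefmx_unit M : posdefmx M -> M \in unitmx.
Proof.
move=> [_ pM]; rewrite -row_free_unit; apply: inj_row_free => v vM.
apply/eqP; apply: contraTT isT => v0.
have /pM : v^T != 0 by rewrite trmx_eq0.
by rewrite trmxK vM mul0mx mxE ltxx.
Qed.

Lemma posdefmx_inv M : posdefmx M -> posdefmx (invmx M).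
Proof.
move=> pM; have uM := posdefmx_unit pM.
have sV : (invmx M)^T = invmx M by rewrite trmx_inv pM.1.
split=> // x x0; have := pM.2 (invmx M *m x).
rewrite trmx_mul sV -!mulmxA mulKVmx //; apply.
by apply: contraNneq x0 => h; rewrite -(mulKVmx uM x) h mulmx0.
Qed.

(** The coordinate [x_i] is the inner product, for the form [M], of [x] with
    [M^-1 e_i]; Cauchy-Schwarz bounds its square by [(M^-1)_ii] times
    [x^T M x], and summing over [i] makes the trace of [M^-1] appear. *)
Lemma posdefmx_coercive M : posdefmx M ->
  exists2 a, 0 < a & forall x, a * sqnorm x <= bform M x x.
Proof.
move=> pM; have uM := posdefmx_unit pM.
pose e i : 'cV[R]_n := delta_mx i 0.
pose g i := bform (invmx M) (e i) (e i).
have g0 i : 0 <= g i by apply/bform_ge0/posdefmx_inv.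
have s0 : 0 < 1 + \sum_i g i by rewrite ltr_pwDl // sumr_ge0.
(* The summand 1 keeps the constant positive when [n = 0]. *)
exists (1 + \sum_i g i)^-1; first by rewrite invr_gt0.
move=> x; rewrite mulrC ler_pdivrMr // mulrC.
have coord i : x i 0 ^+ 2 <= g i * bform M x x.
  have := Cauchy_Schwarz_bform x (invmx M *m e i) pM.
  have sV : (invmx M)^T = invmx M by rewrite trmx_inv pM.1.
  rewrite /g /bform trmx_mul sV -!mulmxA mulKVmx // mulKmx //.
  by rewrite trmx_delta -rowE mxE.
apply: (le_trans (ler_sum _ (fun i _ => coord i))).
by rewrite -mulr_suml ler_wpM2r ?bform_ge0 // lerDr.
Qed.

Lemma bform_bounded M :
  exists2 C, 0 < C & forall x, bform M x x <= C * sqnorm x.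
Proof.
exists (1 + \sum_i \sum_j `|M i j|).
  by rewrite ltr_pwDl // sumr_ge0 // => i _; rewrite sumr_ge0.
move=> x.
have sq i : x i 0 ^+ 2 <= sqnorm x.
  by rewrite /sqnorm (bigD1 i) //= lerDl sumr_ge0 // => j _; exact: sqr_ge0.
apply: (@le_trans _ _ ((\sum_i \sum_j `|M i j|) * sqnorm x)); last first.
  by rewrite ler_wpM2r ?sqnorm_ge0 // lerDr.
rewrite bformE mulr_suml; apply: ler_sum => i _.
rewrite mulr_suml; apply: ler_sum => j _.
apply: (le_trans (ler_norm _)); rewrite normrM ler_wpM2l //.
(* [|x_i| |x_j|] is at most the mean of [x_i^2] and [x_j^2]. *)
have := sq i; have := sq j; have := sqr_ge0 (`|x i 0| - `|x j 0|).
rewrite normrM -(real_normK (num_real (x i 0))).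
rewrite -(real_normK (num_real (x j 0))).
nra.
Qed.

(** Congruence by the symmetric matrix [Q^-1]: multiplying
    [A Q + Q A^T] by it on both sides gives [Q^-1 A + A^T Q^-1]. *)
Lemma negdefmx_lyapunov_inv Q A : posdefmx Q ->
  negdefmx (A *m Q + Q *m A^T) ->
  negdefmx (invmx Q *m A + A^T *m invmx Q).
Proof.
move=> pQ [_ nM]; have uQ := posdefmx_unit pQ.
have sV : (invmx Q)^T = invmx Q by rewrite trmx_inv pQ.1.
split; first by rewrite linearD /= !trmx_mul trmxK sV addrC.
move=> x x0; have := nM (invmx Q *m x).
rewrite trmx_mul sV.
have -> : x^T *m invmx Q *m (A *m Q + Q *m A^T) *m (invmx Q *m x) =
          x^T *m (invmx Q *m A + A^T *m invmx Q) *m x.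
  by rewrite !mulmxDr !mulmxDl -!mulmxA mulKVmx // mulKmx.
apply; apply: contraNneq x0 => h.
by rewrite -(mulKVmx uQ x) h mulmx0.
Qed.

Lemma negdefmx_bound M : negdefmx M ->
  exists2 w, 0 < w & forall x, bform M x x <= - (w * sqnorm x).
Proof.
move=> [sM nM].
have /posdefmx_coercive[w w0 hw] : posdefmx (- M).
  split; first by rewrite linearN /= sM.
  by move=> x /nM; rewrite mulmxN mulNmx [X in _ -> _ < X]mxE oppr_gt0.
exists w => // x; rewrite lerNr; apply: le_trans (hw x) _.
by rewrite /bform mulmxN mulNmx mxE.
Qed.

End Forms.

(** * Exponential decay of a quadratic Lyapunov function *)

Section ExponentialDecay.
Variables (R : realType) (n : nat).
Implicit Types (F : 'cV[R]_n -> 'cV[R]_n) (P : 'M[R]_n).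

Lemma is_derive_coord m p (f : R -> 'M[R]_(m, p)) (t : R) (df : 'M[R]_(m, p))
    i j :
  is_derive t 1 f df -> is_derive t 1 (fun s => f s i j) (df i j).
Proof.
move=> [/[dup] /derivable_mxP/(_ i j) fij dvf fE]; split=> //.
by rewrite -fE derive_mx // mxE.
Qed.

Lemma is_derive_bform P (f : R -> 'cV[R]_n) (t : R) (df : 'cV[R]_n) :
  is_derive t 1 f df ->
  is_derive t 1 (fun s => bform P (f s) (f s))
    (bform P (f t) df + bform P df (f t)).
Proof.
move=> hf; have hc i := is_derive_coord i 0 hf.
have -> : (fun s => bform P (f s) (f s)) =
    \sum_i \sum_j (fun s => P i j *: (f s i 0 * f s j 0)).
  apply/funext => s; rewrite bformE fct_sumE; apply: eq_bigr => i _.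
  by rewrite fct_sumE.
have hp i j : is_derive t 1 (fun s => P i j *: (f s i 0 * f s j 0))
    (P i j *: (f t i 0 *: df j 0 + f t j 0 *: df i 0)).
  by apply: is_deriveZ; apply: is_deriveM.
apply: (is_derive_eq (is_derive_sum (fun i => is_derive_sum (hp i)))).
rewrite !bformE -big_split; apply: eq_bigr => i _.
rewrite -big_split; apply: eq_bigr => j _ /=.
rewrite /GRing.scale /=; ring.
Qed.

Lemma continuous_bform P : continuous (fun x : 'cV[R]_n => bform P x x).
Proof.
rewrite (_ : (fun _ => _) =
    (fun y : 'cV[R]_n => \sum_i \sum_j P i j * (y i 0 * y j 0))); last first.
  by apply/funext => y; rewrite bformE.
apply: continuous_big => [|i _]; first exact: add_continuous.
apply: continuous_big => [|j _ x]; first exact: add_continuous.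
apply: (@continuousM _ _ (cst (P i j)) (fun y : 'cV[R]_n => y i 0 * y j 0)).
  exact: cst_continuous.
by apply: (@continuousM _ _ (fun y : 'cV[R]_n => y i 0) (fun y => y j 0));
  exact: coord_continuous.
Qed.

(** With [a |x|^2 <= V(x) <= C |x|^2] for [V(x) = x^T P x], the hypothesis gives
    [V' <= - k V] along solutions, where [k = w / C]. So [V(x(t)) e^(kt)]
    is nonincreasing, and [|x(t)|^2 <= (C / a) e^(-kt) |x(0)|^2]. *)
Lemma lyapunov_exponential_stability F P (w : R) : posdefmx P -> 0 < w ->
  (forall x, bform P x (F x) + bform P (F x) x <= - (w * sqnorm x)) ->
  globally_exponentially_stable F.
Proof.
move=> pP w0 decr.
have [a a0 lowP] := posdefmx_coercive pP.
have [C C0 upP] := bform_bounded P.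
pose k := w / C.
have k0 : 0 < k by rewrite divr_gt0.
exists (Num.sqrt (C / a)), (k / 2); split; rewrite ?sqrtr_gt0 ?divr_gt0 //.
move=> x [cx dx] t t0.
pose V s := bform P (x s) (x s).
pose g s := V s * expR (k * s).
have dg (s : R) : 0 < s -> is_derive s 1 g
    (V s *: (expR (k * s) * k) +
     expR (k * s) *: (bform P (x s) (F (x s)) + bform P (F (x s)) (x s))).
  move=> s0.
  have dV := is_derive_bform P (dx s s0).
  have dk : is_derive s 1 (fun u : R => k * u) k.
    apply: (is_derive_eq (is_deriveZ k (is_derive_id s 1))).
    by rewrite /GRing.scale /= mulr1.
  have dE : is_derive s 1 (fun u => expR (k * u)) (expR (k * s) * k).
    exact: (is_derive1_comp (is_derive_expR (k * s)) dk).
  exact: is_deriveM.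
have gdecr : g t <= g 0.
  apply: (@ler0_derive1_nincry _ g 0) => //.
  - by move=> s; rewrite in_itv /= andbT => /dg[].
  - move=> s; rewrite in_itv /= andbT => s0.
    have [_ dgs] := dg s s0.
    rewrite derive1E dgs /GRing.scale /=.
    rewrite [X in X + _](_ : _ = expR (k * s) * (k * V s)); last by ring.
    rewrite -mulrDr pmulr_rle0 ?expR_gt0 //.
    have : k * V s <= w * sqnorm (x s).
      rewrite /k mulrAC ler_pdivrMr // -mulrA ler_pM2l // mulrC.
      exact: upP.
    have := decr (x s); lra.
  - have -> : [set` `[0, +oo[%R] = [set u : R | 0 <= u].
      by apply/seteqP; split => u /=; rewrite in_itv /= andbT.
    have cV : {within [set u : R | 0 <= u], continuous V}.
      have := @within_continuous_comp _ _ _ _ x (fun y => bform P y y) _ cx.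
      apply => y _; exact: continuous_bform.
    move=> s; apply: cvgM; first exact: cV.
    apply: continuous_subspaceT => u.
    apply: continuous_comp; last exact: continuous_expR.
    by apply: cvgM; [exact: cvg_cst | exact: cvg_id].
have V0 : g 0 = V 0 by rewrite /g mulr0 expR0 mulr1.
have bound : sqnorm (x t) <= (C / a) * expR (- k * t) * sqnorm (x 0).
  have Vt : V t <= expR (- k * t) * V 0.
    rewrite mulNr expRN mulrC ler_pdivlMr ?expR_gt0 //.
    by rewrite -V0; exact: gdecr.
  have lo := lowP (x t).
  have up : expR (- k * t) * V 0 <= expR (- k * t) * (C * sqnorm (x 0)).
    by rewrite ler_pM2l ?expR_gt0 //; exact: upP.
  have := le_trans lo (le_trans Vt up).
  rewrite mulrC -ler_pdivlMr // => /le_trans; apply.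
  rewrite le_eqVlt; apply/orP; left; apply/eqP; ring.
rewrite /euclidean_norm -!/(sqnorm _).
have -> : expR (- (k / 2) * t) = Num.sqrt (expR (- k * t)).
  rewrite (_ : expR (- k * t) = expR (- (k / 2) * t) ^+ 2).
    by rewrite sqrtr_sqr ger0_norm // expR_ge0.
  by rewrite -expRM_natl; congr expR; field.
rewrite -sqrtrM; last by rewrite divr_ge0 // ltW.
rewrite -sqrtrM; last by rewrite mulr_ge0 ?expR_ge0 // divr_ge0 // ltW.
exact: ler_wsqrtr.
Qed.

End ExponentialDecay.

(** * The closed loop of the safety filter *)

Section ClosedLoop.
Variables (R : realType) (n m r : nat).
Variables (A : 'M[R]_n.+1) (B : 'M[R]_(n.+1, m)) (c : 'cV[R]_n.+1) (d : R).
Variables (alpha : 'I_r -> R) (G : 'M[R]_m).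

(** Where the filter is active, [A0 x + eta(x) v1] lies on the segment from
    [A0 x] to [Atilde x = A0 x + (eta(x) - alpha d) v1], because
    [eta(x) - alpha d < eta(x) < 0]. *)
Lemma closed_loop_convex (K : 'M[R]_(m, n.+1)) (x : 'cV[R]_n.+1) :
  0 < d -> (forall j, 0 < alpha j) ->
  exists s : R, [/\ 0 <= s, s <= 1 &
    closed_loop A B c d G alpha K x =
    (1 - s) *: (A0 A B K *m x) + s *: (Atilde A B c G alpha K *m x)].
Proof.
move=> d0 al0; rewrite /closed_loop.
have ad0 : 0 < (\prod_(j < r) alpha j) * d by rewrite mulr_gt0 // prodr_gt0.
case: ifPn => [_|]; first by exists 0; rewrite scale0r addr0 subr0 scale1r.
rewrite -ltNge /btilde /eta /Atilde.
set ad := _ * d in ad0 *; move: (v1 _ _ _ _ _) (v2T _ _ _ _ _) => v u.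
set y := (u *m x) 0 0 => eta0.
have ux : u *m x = y%:M by rewrite [LHS]mx11_scalar.
have y0 : y < 0 by lra.
(* Here [y = eta x - alpha d], so the weight of [Atilde x] is
   [eta x / (eta x - alpha d)]. *)
exists ((y + ad) / y); split.
- by rewrite ler_ndivlMr // mul0r ltW.
- by rewrite ler_ndivrMr // mul1r lerDl ltW.
rewrite mulmxDl -mulmxA ux mul_mx_scalar scalerDr addrA -scalerDl.
rewrite subrK scale1r -addrA -scalerDl scalerA; congr (_ + _ *: _).
by field; rewrite lt_eqF.
Qed.

Lemma common_lyapunov_stable (K : 'M[R]_(m, n.+1)) (P : 'M[R]_n.+1) :
  0 < d -> (forall j, 0 < alpha j) ->
  common_lyapunov (A0 A B K) (Atilde A B c G alpha K) P ->
  globally_exponentially_stable (closed_loop A B c d G alpha K).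
Proof.
move=> d0 al0 [pP /negdefmx_bound[w1 w10 h1] /negdefmx_bound[w2 w20 h2]].
apply: (@lyapunov_exponential_stability _ _ _ P (Num.min w1 w2)) => //.
  by rewrite lt_min w10.
move=> x; have [s [s0 s1 ->]] := closed_loop_convex K x d0 al0.
have := h1 x; have := h2 x; rewrite !bform_lyapunov.
rewrite !(bformDl, bformDr, bformZl, bformZr).
set w := Num.min w1 w2 => H2 H1.
have W1 : w * sqnorm x <= w1 * sqnorm x.
  by rewrite ler_wpM2r ?sqnorm_ge0 // ge_min lexx.
have W2 : w * sqnorm x <= w2 * sqnorm x.
  by rewrite ler_wpM2r ?sqnorm_ge0 // ge_min lexx orbT.
nra.
Qed.

Lemma A0_lmi (K : 'M[R]_(m, n.+1)) (Q : 'M[R]_n.+1) :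
  A0 A B K *m Q = A *m Q + B *m (- K *m Q).
Proof. by rewrite /A0 mulmxBl mulNmx mulmxN mulmxA. Qed.

Lemma Atilde_lmi (K : 'M[R]_(m, n.+1)) (Q : 'M[R]_n.+1) :
  Atilde A B c G alpha K *m Q =
  (A + v1 A B c G r *m c^T *m horner_mx A (phi alpha)) *m Q +
  ((1%:M + v1 A B c G r *m c^T *m A ^+ r.-1) *m B) *m (- K *m Q).
Proof.
rewrite /Atilde /A0 /v2T; set v := v1 _ _ _ _ _; set H := horner_mx _ _.
rewrite [in RHS]mulmxA -mulmxDl; congr (_ *m Q).
rewrite mulmxBr mulmxBr mulmxN !mulmxDl mul1mx !mulmxA.
by rewrite opprD addrACA.
Qed.

End ClosedLoop.

Lemma lmi_lhs (R : realType) (n m : nat) (X M Q : 'M[R]_n) (Z : 'M[R]_(n, m))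
    (Y : 'M[R]_(m, n)) :
  Q^T = Q -> M *m Q = X *m Q + Z *m Y ->
  X *m Q + Q *m X^T + Z *m Y + Y^T *m Z^T = M *m Q + Q *m M^T.
Proof.
move=> sQ ME; have -> : Q *m M^T = (M *m Q)^T by rewrite trmx_mul sQ.
by rewrite ME linearD /= !trmx_mul sQ addrACA addrA.
Qed.

Theorem lemma7 (R : realType) (n m : nat)
    (A : 'M[R]_n.+1) (B : 'M[R]_(n.+1, m)) (c : 'cV[R]_n.+1) (d : R)
    (r : nat) (alpha : 'I_r -> R) (G : 'M[R]_m)
    (hAB : stabilizable A B) (hd : 0 < d) (hr : relative_degree A B c r)
    (halpha : forall j : 'I_r, 0 < alpha j) (hG : posdefmx G) :
  let Ahat := A + v1 A B c G r *m c^T *m horner_mx A (phi alpha) in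
  let Bhat := (1%:M + v1 A B c G r *m c^T *m A ^+ r.-1) *m B in
  let lmi (Q : 'M[R]_n.+1) (Y : 'M[R]_(m, n.+1)) :=
    [/\ posdefmx Q,
        negdefmx (A *m Q + Q *m A^T + B *m Y + Y^T *m B^T) &
        negdefmx (Ahat *m Q + Q *m Ahat^T + Bhat *m Y + Y^T *m Bhat^T)] in
  ((exists (Q : 'M[R]_n.+1) (Y : 'M[R]_(m, n.+1)), lmi Q Y) <->
   (exists (K : 'M[R]_(m, n.+1)) (P : 'M[R]_n.+1),
      common_lyapunov (A0 A B K) (Atilde A B c G alpha K) P)) /\
  (forall (Q : 'M[R]_n.+1) (Y : 'M[R]_(m, n.+1)), lmi Q Y ->
   let P := invmx Q in
   let K := - Y *m invmx Q in
   common_lyapunov (A0 A B K) (Atilde A B c G alpha K) P /\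
   globally_exponentially_stable (closed_loop A B c d G alpha K)).
Proof.
move=> Ahat Bhat lmi.
have sound Q Y : lmi Q Y ->
    common_lyapunov (A0 A B (- Y *m invmx Q))
      (Atilde A B c G alpha (- Y *m invmx Q)) (invmx Q).
  move=> [pQ n1 n2]; have uQ := posdefmx_unit pQ.
  have YE : - (- Y *m invmx Q) *m Q = Y by rewrite !mulNmx opprK mulmxKV.
  split; first exact: posdefmx_inv.
  - apply: negdefmx_lyapunov_inv => //.
    by rewrite -(lmi_lhs pQ.1 (A0_lmi A B _ Q)) YE.
  - apply: negdefmx_lyapunov_inv => //.
    by rewrite -(lmi_lhs pQ.1 (Atilde_lmi A B c alpha G _ Q)) YE.
split; last first.
  move=> Q Y h P K; have L := sound Q Y h; split=> //.
  exact: common_lyapunov_stable L.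
split=> [[Q [Y h]]|[K [P [pP n1 n2]]]].
  by exists (- Y *m invmx Q), (invmx Q); exact: sound.
exists (invmx P), (- K *m invmx P).
have pQ := posdefmx_inv pP.
have dual M : negdefmx (P *m M + M^T *m P) ->
    negdefmx (M *m invmx P + invmx P *m M^T).
  have := @negdefmx_lyapunov_inv _ _ P M^T pP.
  by rewrite trmxK [M^T *m P + _]addrC [_ + invmx P *m _]addrC.
split=> //.
- by rewrite (lmi_lhs pQ.1 (A0_lmi A B K _)); exact: dual.
- by rewrite (lmi_lhs pQ.1 (Atilde_lmi A B c alpha G K _)); exact: dual.
Qed.
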